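(* Let $B$ and $C$ be disjoint finite sets, and let $P_1$ and $P_2$ be bipartite graphs on the vertex set $B\cup C$ in which all edges go between $B$ and $C$, and such that, for some integer $k$, every vertex of $B$ has degree $k$ in $P_1$ and degree $k$ in $P_2$. Suppose that $P_1$ and $P_2$ are cospectral with respect to the normalized Laplacian. Let $A$ and $A'$ be finite sets such that $A,A',B,C$ are pairwise disjoint. Let $G_1$ be a graph on the vertex set $A\cup A'\cup B\cup C$ such that: $G_1[A\cup A']$ is an arbitrary graph; $G_1[B]$ and $G_1[C]$ have no edges; there are no edges between $A$ and $B$, between $A$ and $C$, or between $A'$ and $C$; every vertex of $A'$ is adjacent to every vertex of $B$; and $G_1[B\cup C]=P_1$. Let $G_2$ be the graph on the same vertex set which is the same as $G_1$ except that $G_2[B\cup C]=P_2$ (in particular $G_2[A\cup A']=G_1[A\cup A']$). (i) Then $G_1$ and $G_2$ are cospectral with respect to the normalized Laplacian. (ii) Suppose moreover that the dimension of the intersection of the eigenspace of the normalized Laplacian for the eigenvalue $\lambda=1$ with the subspace of vectors that are nonzero only on $B$ is the same for $P_1$ and for $P_2$. For $j\in\{1,2\}$ let $H_j$ be the graph that differs from $G_j$ only in that $H_j[B]$ is the complete graph on $B$. Then $H_1$ and $H_2$ are also cospectral with respect to the normalized Laplacian.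
   Context: All graphs are finite, simple and undirected. For a graph $G$ and a subset $W$ of its vertices, $G[W]$ is the induced subgraph on $W$. The normalized Laplacian of a graph is $\mathcal{L}=D^{-1/2}(D-\mathrm{Adj})D^{-1/2}$, where $\mathrm{Adj}$ is the adjacency matrix and $D$ is the diagonal matrix of degrees; by convention an isolated vertex contributes an eigenvalue $0$ (its row and column in $\mathcal{L}$ are zero, i.e. its diagonal entry in $D^{-1/2}$ is taken to be $0$). Two graphs are cospectral with respect to a matrix if the associated matrices have the same eigenvalues with the same multiplicities. A vector is ''nonzero only on $B$'' if its entries at all vertices outside $B$ are $0$. *)

(* Defs.v *)
From mathcomp Require Import all_boot all_order all_algebra.
From mathcomp Require Import reals.

Set Implicit Arguments.
Unset Strict Implicit.
Unset Printing Implicit Defensive.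

Import Order.TTheory GRing.Theory Num.Theory.
Local Open Scope ring_scope.

Record sgraph (V : finType) := SGraph {
  adj :> rel V;
  adj_sym : symmetric adj;
  adj_irr : irreflexive adj
}.

Section Graph.
Variable V : finType.
Implicit Types (G H : sgraph V) (S T : {set V}).

Definition degree G (x : V) : nat := #|[set y | G x y]|.

Definition no_edges_between G S T :=
  forall x y, x \in S -> y \in T -> ~~ G x y.

Definition same_except_inside S G H :=
  forall x y, ~~ ((x \in S) && (y \in S)) -> H x y = G x y.

Definition complete_on S G :=
  forall x y, x \in S -> y \in S -> G x y = (x != y).

End Graph.

(* Matrices of a graph on V are indexed by 'I_#|V| through enum_val. *)
Section Laplacian.
Variables (R : realType) (V : finType).
Implicit Types (G : sgraph V) (S : {set V}).

Definition adj_mx G : 'M[R]_#|V| :=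
  \matrix_(i, j) (G (enum_val i) (enum_val j))%:R.

Definition deg_mx G : 'M[R]_#|V| :=
  diag_mx (\row_i (degree G (enum_val i))%:R).

(* As 0^-1 = 0, the entry at an isolated vertex is 0. *)
Definition deg_invsqrt_mx G : 'M[R]_#|V| :=
  diag_mx (\row_i (Num.sqrt (degree G (enum_val i))%:R)^-1).

Definition normalized_laplacian G : 'M[R]_#|V| :=
  deg_invsqrt_mx G *m (deg_mx G - adj_mx G) *m deg_invsqrt_mx G.

(* The row space consists of the vectors that are nonzero only on S; see
   [sub_supported_mx]. *)
Definition supported_mx S : 'M[R]_#|V| :=
  diag_mx (\row_i (enum_val i \in S)%:R).

Lemma sub_supported_mx S (v : 'rV[R]_#|V|) :
  reflect (forall i, enum_val i \notin S -> v 0 i = 0)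
          (v <= supported_mx S)%MS.
Proof.
apply: (iffP idP) => [/submxP[w ->] i iS|vS].
  by rewrite mul_mx_diag !mxE (negbTE iS) mulr0.
apply/submxP; exists v; apply/rowP => i; rewrite mul_mx_diag !mxE.
by have [_|/vS->] := boolP (_ \in S); rewrite ?mulr1 ?mul0r.
Qed.

(* Eigenspaces are spaces of row vectors; this makes no difference here, the
   normalized Laplacian being symmetric. *)
Definition dim_eigenspace_on S (a : R) G : nat :=
  \rank (eigenspace (normalized_laplacian G) a :&: supported_mx S)%MS.

End Laplacian.

(* Equality of the multiplicities of all real eigenvalues, a non-eigenvalue
   having multiplicity 0. For the symmetric matrices considered here, all
   eigenvalues are real. *)
Definition cospectral_mx (R : realType) m n (M : 'M[R]_m) (N : 'M[R]_n) :=
  forall a : R, mup a (char_poly M) = mup a (char_poly N).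

Definition cospectral (R : realType) (V W : finType)
    (G : sgraph V) (H : sgraph W) :=
  cospectral_mx (normalized_laplacian R G) (normalized_laplacian R H).

(* Main.v *)
Require Import Defs.
From mathcomp Require Import all_boot all_order all_algebra.
From mathcomp Require Import reals.
From mathcomp Require Import perm ring lra.

Set Implicit Arguments.
Unset Strict Implicit.
Unset Printing Implicit Defensive.

Import Order.TTheory GRing.Theory Num.Theory.
Local Open Scope ring_scope.

(* Let [N] be the biadjacency matrix of [P], [Delta] the degrees on [C] and
   [S = N Delta^-1 N^T].  As [B] is [k]-regular, [1^T S = k 1^T].  In
   [det (x - L(G))], a Schur complement eliminates [C] and leaves on [B] the
   block [T + beta J], where [T = alpha - S / (m (x - 1))], [m] is the degree in
   [G] of the vertices of [B], and [J] is all-ones.  Since [1^T T = tau 1^T] for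
   a scalar [tau] not depending on [P], multiplying the columns of [B] by [T^-1]
   yields a matrix not depending on [P].  So, up to such factors,
   [det (x - L(G))] is [x^i (x - 1)^(|C| - i)] times the characteristic
   polynomial of [S] at a quadratic polynomial in [x], where [i] is the number of
   isolated vertices in [C].  The same formula for [P] itself shows that its
   spectrum determines [i] and the spectrum of [S], which is nonnegative. *)

(** * Polynomial identities and root multiplicities *)

(** The product [r * (p - q)] vanishes at every natural number, and in a [numDomainType] these are
    pairwise distinct, so it has more roots than its size allows. *)
Lemma eq_poly_off_roots (F : numDomainType) (r p q : {poly F}) :
  r != 0 -> (forall x, r.[x] != 0 -> p.[x] = q.[x]) -> p = q.
Proof.
move=> r0 pq; apply/eqP; rewrite -subr_eq0.
suff /eqP : r * (p - q) = 0 by rewrite mulf_eq0 (negbTE r0).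
apply: (@roots_geq_poly_eq0 _ _ [seq i%:R | i <- iota 0 (size (r * (p - q)))]).
- apply/allP => _ /mapP[i _ ->]; rewrite rootE hornerM !hornerE.
  have [->|/pq->] := eqVneq r.[i%:R] 0; first by rewrite mul0r.
  by rewrite subrr mulr0.
- by rewrite map_inj_uniq ?iota_uniq// => i j /eqP; rewrite eqr_nat => /eqP.
- by rewrite size_map size_iota.
Qed.

Lemma mupE (F : fieldType) (p : {poly F}) (n : nat) (a : F) (r : {poly F}) :
  p = r * ('X - a%:P) ^+ n -> ~~ root r a -> mup a p = n.
Proof. by move=> -> ra; rewrite mupMr// mup_XsubCX eqxx. Qed.

Lemma mup_factor (F : fieldType) (p : {poly F}) (a : F) : p != 0 ->
  exists2 r, p = r * ('X - a%:P) ^+ mup a p & ~~ root r a.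
Proof.
move=> p0; have [m [r ra pE]] := multiplicity_XsubC p a.
by rewrite p0 /= in ra; exists r; rewrite ?(mupE pE ra).
Qed.

Lemma mup_prod (F : fieldType) (I : eqType) (s : seq I) (P : I -> {poly F}) a :
  (forall i, P i != 0) ->
  mup a (\prod_(i <- s) P i) = (\sum_(i <- s) mup a (P i))%N.
Proof.
move=> P0; elim: s => [|i s IHs]; first by rewrite !big_nil mupNroot ?root1.
by rewrite !big_cons mupM ?IHs// prodf_seq_neq0; apply/allP => ? _; exact: P0.
Qed.

Lemma mup_exp (F : fieldType) (p : {poly F}) a n :
  p != 0 -> mup a (p ^+ n) = (n * mup a p)%N.
Proof.
move=> p0; elim: n => [|n IHn]; first by rewrite mupNroot ?root1.
by rewrite exprS mupM ?expf_neq0// IHn mulSn.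
Qed.

(** Splitting [p] as [r * ('X - q.[a]) ^+ m] with [r] nonzero at [q.[a]], composition gives a power
    of [q - q.[a]] times a factor that does not vanish at [a]. The size condition keeps [q - q.[a]]
    nonzero. *)
Lemma mup_comp (F : fieldType) (p q : {poly F}) a :
  (1 < size q)%N -> p != 0 ->
  mup a (p \Po q) = (mup q.[a] p * mup a (q - q.[a]%:P))%N.
Proof.
move=> q1 p0; have [r pE ra] := mup_factor q.[a] p0.
rewrite {1}pE rmorphM rmorphXn /= comp_polyB comp_polyX comp_polyC mupMr.
  rewrite mup_exp//; apply: contraTneq q1 => /eqP; rewrite subr_eq0 => /eqP->.
  by rewrite -leqNgt size_polyC_leq1.
by rewrite rootE horner_comp.
Qed.

(** * Determinants: Schur complement, reindexing, and extraction of a common factor *)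

Lemma horner_char_poly (F : comNzRingType) n (A : 'M[F]_n) x :
  (char_poly A).[x] = \det (x%:M - A).
Proof.
rewrite -[LHS]/(horner_eval x _) -det_map_mx; congr (\det _).
by apply/matrixP => i j; rewrite !mxE /= /horner_eval !hornerE hornerMn hornerX.
Qed.

(** Right multiplication by a block unitriangular matrix clears the lower left block. *)
Lemma det_block_schur (F : fieldType) m n (A : 'M[F]_m) (B : 'M_(m, n))
    (C : 'M_(n, m)) (D : 'M_n) : D \in unitmx ->
  \det (block_mx A B C D) = \det D * \det (A - B *m invmx D *m C).
Proof.
move=> uD; have : block_mx A B C D *m block_mx 1%:M 0 (- (invmx D *m C)) 1%:M
    = block_mx (A - B *m invmx D *m C) B 0 D.
  rewrite mulmx_block !mulmx1 !mulmx0 !add0r !mulmxN !mulmxA mulmxV// mul1mx.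
  by rewrite subrr.
move/(congr1 determinant); rewrite det_mulmx det_lblock det_ublock !det1 !mulr1.
by rewrite mulrC.
Qed.

(** Between ordinals of equal size [f] is a permutation; applied to both rows and columns, its sign
    occurs twice and cancels. *)
Lemma det_reindex (F : comNzRingType) m n (f : 'I_m -> 'I_n) (A : 'M[F]_n) :
  m = n -> injective f -> \det (\matrix_(i, j) A (f i) (f j)) = \det A.
Proof.
move=> eq_mn; case: n / eq_mn f A => f A injf.
have -> : \matrix_(i, j) A (f i) (f j) = row_perm (perm injf) (col_perm (perm injf) A).
  by apply/matrixP => i j; rewrite !mxE !permE.
rewrite row_permE col_permE !det_mulmx !det_perm odd_permV mulrCA.
by rewrite -signr_addb addbb mulr1.
Qed.

Lemma const_row_invmx (F : fieldType) n (T : 'M[F]_n) (t : F) :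
  T \in unitmx -> const_mx 1 *m T = t *: const_mx 1 :> 'rV_n ->
  const_mx 1 *m invmx T = t^-1 *: const_mx 1 :> 'rV_n.
Proof.
move=> uT eT; have : (const_mx 1 : 'rV_n) = t *: (const_mx 1 *m invmx T).
  by rewrite scalemxAl -eT mulmxK.
(* If [t] is 0, the previous identity makes the all-ones row zero (so [n] is 0), and both sides
   vanish. *)
have [->|t0 {2}->] := eqVneq t 0; last by rewrite scalerA mulVf// scale1r.
by rewrite scale0r => ->; rewrite mul0mx scaler0.
Qed.

(* The point is that the last determinant depends on [M] and [D] only through
   [kappa] and [y]. *)
Lemma det_schur_factor (F : fieldType) w b c (Y : 'M[F]_w) (u : 'cV_w)
    (v : 'rV_w) (M : 'M_(b, c)) (D : 'M_c) (alpha beta y kappa : F) :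
  let T := alpha%:M - y^-1 *: (M *m M^T) in
  let t := alpha - y^-1 * kappa in
  let e := const_mx 1 : 'rV_b in
  y != 0 -> D \in unitmx -> T \in unitmx -> D *m M^T = y *: M^T ->
  e *m (M *m M^T) = kappa *: e ->
  \det (block_mx (block_mx Y (u *m e) (e^T *m v) (alpha%:M + beta *: (e^T *m e)))
                 (col_mx 0 M) (row_mx 0 M^T) D) =
  \det D * \det T *
  \det (block_mx Y (t^-1 *: (u *m e)) (e^T *m v)
                 (1%:M + (beta / t) *: (e^T *m e))).
Proof.
move=> T t e y0 uD uT DM MM; rewrite det_block_schur// -mulrA; congr (_ * _).
(* On the columns of [M^T] the matrix [D] acts as the scalar [y], so its inverse acts as [y^-1]. *)
have iDM : invmx D *m M^T = y^-1 *: M^T.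
  apply: (can_inj (mulKmx uD)).
  by rewrite mulKVmx// -scalemxAr DM scalerA mulVf ?scale1r.
have eT : e *m T = t *: e.
  by rewrite mulmxBr mul_mx_scalar -scalemxAr MM scalerA -scalerBl.
have iT := const_row_invmx uT eT.
rewrite -mulmxA mul_mx_row mulmx0 mul_col_row !mul0mx mulmx0 iDM -scalemxAr.
rewrite opp_block_mx add_block_mx !oppr0 !addr0.
(* [T] is pulled out of the second block column; by [iT], a row [e] in that column becomes
   [t^-1 *: e]. *)
have -> : block_mx Y (u *m e) (e^T *m v)
    (alpha%:M + beta *: (e^T *m e) - y^-1 *: (M *m M^T)) =
  block_mx Y (t^-1 *: (u *m e)) (e^T *m v) (1%:M + (beta / t) *: (e^T *m e)) *m
  block_mx 1%:M 0 0 T.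
  rewrite mulmx_block !mulmx1 !mulmx0 !addr0 !add0r.
  rewrite -scalerA !scalemxAr -iT -!mulmxA mulmxDl mul1mx -mulmxA -scalemxAl.
  by rewrite mulmxKV// mulVmx// mulmx1 -!scalemxAr addrAC.
by rewrite det_mulmx det_lblock det1 mul1r mulrC.
Qed.

(** * The common shape of all the graphs, and its block indexing *)

Section Glue.
Variables (W B C : finType).

(* [h] tells whether [B] is a clique, and [s] is the set of the vertices of [W]
   joined to all of [B]. *)
Definition glue (a : rel W) (s : pred W) (h : bool) (N : B -> C -> bool)
    (x y : W + B + C) : bool :=
  match x, y with
  | inl (inl w), inl (inl w') => a w w'
  | inl (inl w), inl (inr _) | inl (inr _), inl (inl w) => s w
  | inl (inr b), inl (inr b') => h && (b != b')
  | inl (inr b), inr c | inr c, inl (inr b) => N b c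
  | _, _ => false
  end.

(** The order [W], [B], [C] matches the nesting of [block_mx] in [det_schur_factor]. *)
Definition block_val (i : 'I_(#|W| + #|B| + #|C|)) : W + B + C :=
  match split i with
  | inl j => inl (match split j with
                  | inl w => inl (enum_val w)
                  | inr b => inr (enum_val b) end)
  | inr c => inr (enum_val c)
  end.

Lemma block_val_l w : block_val (lshift _ (lshift _ w)) = inl (inl (enum_val w)).
Proof. by rewrite /block_val !(unsplitK (inl _)). Qed.

Lemma block_val_m b : block_val (lshift _ (rshift _ b)) = inl (inr (enum_val b)).
Proof. by rewrite /block_val (unsplitK (inl _)) (unsplitK (inr _)). Qed.

Lemma block_val_r c : block_val (rshift _ c) = inr (enum_val c).
Proof. by rewrite /block_val (unsplitK (inr _)). Qed.

Lemma block_val_inj : injective block_val.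
Proof.
move=> i j; case: (split_ordP i) => [i'|c] ->; last first.
  rewrite block_val_r; case: (split_ordP j) => [j'|c'] ->; last first.
    by rewrite block_val_r => -[/enum_val_inj->].
  by case: (split_ordP j') => j'' ->; rewrite ?block_val_l ?block_val_m.
case: (split_ordP i') => i'' ->; rewrite ?block_val_l ?block_val_m;
  (case: (split_ordP j) => [j'|c'] ->; last by rewrite block_val_r);
  case: (split_ordP j') => j'' ->; rewrite ?block_val_l ?block_val_m//;
  by move=> [/enum_val_inj->].
Qed.

End Glue.

(** * Entries of the Laplacian and its characteristic polynomial in block order *)

Section Laplacian.
Variables (R : realType) (V : finType).

Lemma normalized_laplacianE (G : sgraph V) i j :
  normalized_laplacian R G i j =
    ((i == j) && (degree G (enum_val i) != 0)%N)%:R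
    - (G (enum_val i) (enum_val j))%:R
      / (Num.sqrt (degree G (enum_val i))%:R * Num.sqrt (degree G (enum_val j))%:R).
Proof.
rewrite /normalized_laplacian mul_mx_diag mxE mul_diag_mx !mxE.
rewrite mulrBr mulrBl; congr (_ - _); last by rewrite invfM; ring.
have [<-|_] := eqVneq i j; last by rewrite mulr0n mulr0 mul0r.
rewrite mulr1n andTb; set d := degree _ _.
have [->|d0] := eqVneq d 0; first by rewrite mulr0 mul0r.
rewrite mulrAC -invfM -expr2 sqr_sqrtr ?ler0n// mulVf// pnatr_eq0.
by [].
Qed.

Lemma degreeE (G : sgraph V) x : degree G x = (\sum_y G x y)%N.
Proof.
rewrite /degree -sum1dep_card [LHS]big_mkcond.
by apply: eq_bigr => y; case: (G x y).
Qed.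

Lemma horner_char_laplacian (G : sgraph V) (W B C : finType)
    (e : W + B + C -> V) x : bijective e ->
  (char_poly (normalized_laplacian R G)).[x] =
  \det (\matrix_(i, j) (x *+ (i == j) - normalized_laplacian R G
     (enum_rank (e (block_val i))) (enum_rank (e (block_val j))))).
Proof.
move=> bije; rewrite horner_char_poly.
rewrite -(@det_reindex _ _ _ (fun i => enum_rank (e (block_val i)))).
- congr determinant; apply/matrixP => i j; rewrite !mxE.
  rewrite (inj_eq enum_rank_inj) (inj_eq (bij_inj bije)).
  by rewrite (inj_eq (@block_val_inj _ _ _)).
- by rewrite -(bij_eq_card bije) !card_sum.
- by move=> i j /enum_rank_inj /(bij_inj bije) /block_val_inj.
Qed.

End Laplacian.

(** * The Gram matrix of the bipartite part *)

Section Bipartite.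
Variables (R : realType) (B C : finType) (N : B -> C -> bool).

Definition col_deg (c : C) : nat := (\sum_b N b c)%N.

(** This is [N Delta^(-1/2)], so that [gram] is the matrix [S] of the overview. The column of an
    isolated vertex of [C] is zero. *)
Definition scaled_biadj : 'M[R]_(#|B|, #|C|) :=
  \matrix_(i, j) ((N (enum_val i) (enum_val j))%:R
                  / Num.sqrt (col_deg (enum_val j))%:R).

Definition gram : 'M[R]_#|B| := scaled_biadj *m scaled_biadj^T.

(* [det (x - L)] restricted to [C]: [L] has diagonal entry 0 at an isolated
   vertex and 1 elsewhere. *)
Definition isolated_poly : {poly R} :=
  \prod_(j < #|C|) ('X - ((col_deg (enum_val j) != 0)%N%:R)%:P).

Lemma col_deg_gt0 b c : N b c -> (0 < col_deg c)%N.
Proof. by move=> Nbc; rewrite /col_deg (bigD1 b)//= Nbc. Qed.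

(** Column [c] of [scaled_biadj] sums to the square root of [col_deg c], which cancels the other
    weight; what remains is a row sum of [N]. *)
Lemma const_mul_gram k : (forall b, (\sum_c N b c)%N = k) ->
  const_mx 1 *m gram = k%:R *: const_mx 1 :> 'rV_#|B|.
Proof.
move=> Nk; rewrite mulmxA; apply/rowP => i; rewrite !mxE mulr1.
rewrite -(Nk (enum_val i)) natr_sum (reindex _ (onW_bij _ (@enum_val_bij C))).
apply: eq_bigr => j _; rewrite !mxE; set c := enum_val j.
under eq_bigr do rewrite !mxE mul1r.
rewrite -mulr_suml.
rewrite -(reindex _ (onW_bij _ (@enum_val_bij B)) (P := predT)
  (F := fun b => (N b c)%:R)).
rewrite -natr_sum -/(col_deg c).
have [Nic|_] := boolP (N _ c); last by rewrite mul0r mulr0.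
rewrite mulrACA -invfM -expr2 sqr_sqrtr ?ler0n// mulr1 divff// pnatr_eq0.
by rewrite -lt0n (col_deg_gt0 Nic).
Qed.

(** [gram] is positive semidefinite: for an eigenvector [v], the product of [b] and the squared norm
    of [v] is the squared norm of [v *m scaled_biadj]. *)
Lemma char_poly_gram_lt0 (b : R) : b < 0 -> ~~ root (char_poly gram) b.
Proof.
rewrite ltNge; apply: contra; rewrite -eigenvalue_root_char => /eigenvalueP[v vS v0].
have := congr1 (fun w => (w *m v^T) 0 0) vS.
rewrite /gram mulmxA -mulmxA -trmx_mul -scalemxAl.
have sq n (w : 'rV[R]_n) : (w *m w^T) 0 0 = \sum_i w 0 i ^+ 2.
  by rewrite mxE; apply: eq_bigr => i _; rewrite mxE expr2.
rewrite sq mxE sq => bv; have : 0 <= b * \sum_i v 0 i ^+ 2.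
  by rewrite -bv sumr_ge0// => i _; rewrite sqr_ge0.
rewrite pmulr_lge0// lt_def sumr_ge0 ?andbT => [|i _]; last exact: sqr_ge0.
apply: contra v0; rewrite psumr_eq0 => [/allP v0|i _]; last exact: sqr_ge0.
apply/eqP/rowP => i; rewrite mxE; apply/eqP.
by have := v0 i (mem_index_enum i); rewrite sqrf_eq0.
Qed.

End Bipartite.

(** * The characteristic polynomial of a glued graph *)

Section GlueCharPoly.
Variables (R : realType) (W B C : finType).
Variables (a : rel W) (s : pred W) (h : bool) (k : nat).

Definition w_deg w := (\sum_w' a w w' + s w * #|B|)%N.
Definition b_deg := (\sum_w s w + h * #|B|.-1 + k)%N.

(* The value at which the characteristic polynomial of [gram] is taken; it is
   [alpha / delta] when the block of [B] is [alpha - delta * gram] plus a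
   multiple of the all-ones matrix. *)
Definition glue_quad : {poly R} :=
  ('X - 1) * (b_deg%:R *: ('X - 1) - h%:R%:P).

(** This is the last determinant of [det_schur_factor] for [y = x - 1], [alpha = x - 1 - h / b_deg],
    [beta = h / b_deg] and [kappa = k / b_deg]. The relation [N] does not occur in it. *)
Definition glue_cst (x : R) : R :=
  let e : 'rV[R]_#|B| := const_mx 1 in
  let u : 'cV[R]_#|W| := \col_i ((s (enum_val i))%:R
      / (Num.sqrt (w_deg (enum_val i))%:R * Num.sqrt b_deg%:R)) in
  let Y : 'M[R]_#|W| := \matrix_(i, j) (x *+ (i == j) -
     (((i == j) && (w_deg (enum_val i) != 0)%N)%:R
      - (a (enum_val i) (enum_val j))%:R
        / (Num.sqrt (w_deg (enum_val i))%:R * Num.sqrt (w_deg (enum_val j))%:R))) in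
  let t := (x - 1 - h%:R / b_deg%:R) - (x - 1)^-1 * (k%:R / b_deg%:R) in
  \det (block_mx Y (t^-1 *: (u *m e)) (e^T *m u^T)
                 (1%:M + (h%:R / b_deg%:R / t) *: (e^T *m e))).

Variables (V : finType) (G : sgraph V) (e : W + B + C -> V) (N : B -> C -> bool).
Hypotheses (bije : bijective e)
  (Ge : forall x y, G (e x) (e y) = glue a s h N x y)
  (Nk : forall b, (\sum_c N b c)%N = k).

Lemma degree_glue x : degree G (e x) = match x with
  | inl (inl w) => w_deg w | inl (inr _) => b_deg | inr c => col_deg N c end.
Proof.
rewrite degreeE (reindex _ (onW_bij _ bije)) /=.
under eq_bigr do rewrite Ge; rewrite !big_sumType /=.
case: x => [[w|b]|c] /=.
- by rewrite sum_nat_const [X in (_ + X)%N]big1 ?addn0 1?mulnC.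
- rewrite Nk; congr (_ + _ + _)%N; case: h => /=; last by rewrite big1.
  rewrite mul1n -(cardC1 b) -sum1_card [RHS]big_mkcond; apply: eq_bigr => b' _.
  by rewrite !inE eq_sym; case: eqP.
- by rewrite [X in (X + _ + _)%N]big1// [X in (_ + X)%N]big1// addn0.
Qed.

(** [det_schur_factor] applies: [x != 0] and [x != 1] make the block [D] of [C] invertible, and the
    nonvanishing of the characteristic polynomial of [gram] makes [T] invertible. *)
Lemma char_poly_glue (x : R) : (0 < b_deg)%N -> x != 0 -> x != 1 ->
  (char_poly (gram R N)).[glue_quad.[x]] != 0 ->
  (char_poly (normalized_laplacian R G)).[x] * (b_deg%:R * (x - 1)) ^+ #|B| =
  (isolated_poly R N).[x] * (char_poly (gram R N)).[glue_quad.[x]] * glue_cst x.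
Proof.
move=> m_gt0 x0 x1; rewrite (horner_char_laplacian _ _ bije).
set m : R := b_deg%:R; have m0 : m != 0 by rewrite pnatr_eq0 -lt0n.
have sm : Num.sqrt m * Num.sqrt m = m by rewrite -expr2 sqr_sqrtr ?ler0n.
have y0 : x - 1 != 0 by rewrite subr_eq0.
set M := (Num.sqrt m)^-1 *: scaled_biadj R N.
set D : 'M[R]_#|C| := diag_mx (\row_j (x - (col_deg N (enum_val j) != 0)%N%:R)).
have MM : M *m M^T = m^-1 *: gram R N.
  by rewrite linearZ -scalemxAl -scalemxAr scalerA -invfM sm.
set alpha := x - 1 - h%:R / m.
set T := alpha%:M - (x - 1)^-1 *: (M *m M^T).
(* Scaling [T] by [b_deg * (x - 1)] clears both denominators and gives [glue_quad.[x]] minus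
   [gram]. *)
have TE : (m * (x - 1)) ^+ #|B| * \det T = (char_poly (gram R N)).[glue_quad.[x]].
  rewrite horner_char_poly -detZ; congr determinant.
  rewrite scalerBr scale_scalar_mx; congr (_%:M - _).
    by rewrite /alpha /glue_quad !hornerE -/m; field.
  by rewrite MM !scalerA (_ : _ * _ = 1) ?scale1r//; field; rewrite m0.
rewrite -TE mulf_eq0 negb_or => /andP[_ T0].
have DE : \det D = (isolated_poly R N).[x].
  rewrite det_diag horner_prod; apply: eq_bigr => j _.
  by rewrite mxE !hornerE.
have uD : D \in unitmx.
  rewrite unitmxE unitfE det_diag; apply/prodf_neq0 => j _; rewrite mxE.
  by case: (col_deg _ _ == _); rewrite ?subr0. 
have uT : T \in unitmx by rewrite unitmxE unitfE.
(* At an isolated vertex [D] has the entry [x] instead of [x - 1], but there the row of [M^T] is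
   zero. *)
have DM : D *m M^T = (x - 1) *: M^T.
  apply/matrixP => i j; rewrite mul_diag_mx !mxE.
  have [/col_deg_gt0|_] := boolP (N _ _); last by rewrite mul0r !mulr0.
  by rewrite lt0n => ->.
have eMM : const_mx 1 *m (M *m M^T) = (k%:R / m) *: const_mx 1 :> 'rV_#|B|.
  by rewrite MM -scalemxAr (const_mul_gram _ Nk) scalerA mulrC.
have := det_schur_factor _ _ _ (h%:R / m) y0 uD uT DM eMM.
rewrite /= => key; rewrite -DE /glue_cst /= -/m -/alpha.
rewrite [RHS]mulrAC [in RHS]mulrCA [RHS]mulrC; congr (_ * _).
rewrite mulrAC -key {key}.
(* It remains to identify [x - L] with the block matrix, entry by entry in the nine blocks. *)
congr determinant; apply/matrixP => i j; rewrite [LHS]mxE.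
rewrite normalized_laplacianE !enum_rankK !degree_glue Ge.
rewrite (inj_eq enum_rank_inj) (inj_eq (bij_inj bije)) (inj_eq (@block_val_inj _ _ _)).
case: (split_ordP i) => [i'|c] ->; [case: (split_ordP i') => i'' -> |];
  (case: (split_ordP j) => [j'|c'] ->; [case: (split_ordP j') => j'' -> |]);
  rewrite ?(block_val_l, block_val_m, block_val_r) /= ?eq_shift
    ?(block_mxEul, block_mxEur, block_mxEdl, block_mxEdr,
      col_mxEu, col_mxEd, row_mxEl, row_mxEr).
all: rewrite ![in RHS]mxE ?(mul0r, sub0r, oppr0, opprK, mulr0n, subr0, sm) //.
- by rewrite big_ord1 !mxE mulr1.
- by rewrite big_ord1 !mxE mul1r [_ * Num.sqrt m]mulrC.
- rewrite big_ord1 !mxE mulr1 (inj_eq enum_val_inj) -lt0n m_gt0 andbT.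
  by rewrite /alpha; case: eqP; case: h => _ /=; rewrite ?mulr0n ?mulr1n; ring.
- by rewrite invfM; ring.
- by rewrite invfM; ring.
- by case: eqP => _; rewrite ?mulr0n ?subr0.
Qed.
End GlueCharPoly.

(** * Comparing multiplicities for two glued graphs *)

(** Serves to extend [char_poly_glue] past its excluded points: 0, 1 and the roots of the composed
    characteristic polynomials, all roots of a single nonzero polynomial. *)
Lemma eq_poly_off01 (F : numDomainType) (r1 r2 p q : {poly F}) :
  r1 != 0 -> r2 != 0 ->
  (forall x, x != 0 -> x != 1 -> r1.[x] != 0 -> r2.[x] != 0 -> p.[x] = q.[x]) ->
  p = q.
Proof.
move=> r10 r20 pq; apply: (@eq_poly_off_roots _ ('X * ('X - 1%:P) * (r1 * r2))).
  by rewrite !mulf_neq0 ?polyX_eq0 ?polyXsubC_eq0.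
move=> x; rewrite !hornerM hornerX hornerXsubC !mulf_eq0 !negb_or subr_eq0.
by move=> /andP[/andP[x0 x1] /andP[? ?]]; apply: pq.
Qed.

Lemma eq_adj_cospectral (R : realType) (V : finType) (G H : sgraph V) :
  G =2 H -> cospectral R G H.
Proof.
move=> GH; rewrite /cospectral.
suff -> : normalized_laplacian R G = normalized_laplacian R H by [].
have dGH x : degree G x = degree H x.
  by rewrite !degreeE; apply: eq_bigr => y _; rewrite GH.
by apply/matrixP => i j; rewrite !normalized_laplacianE !dGH GH.
Qed.

Lemma char_poly_neq0 (F : nzRingType) n (A : 'M[F]_n) : char_poly A != 0.
Proof. exact: monic_neq0 (char_poly_monic A). Qed.

Lemma mup_sub_horner_gt0 (F : fieldType) (q : {poly F}) a :
  (1 < size q)%N -> (0 < mup a (q - q.[a]%:P))%N.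
Proof.
move=> q1; rewrite -XsubC_dvd; first by rewrite dvdp_XsubCl rootE !hornerE subrr.
apply: contraTneq q1 => /eqP; rewrite subr_eq0 => /eqP->.
by rewrite -leqNgt size_polyC_leq1.
Qed.

Lemma mup_cross_mul (F : fieldType) (p1 p2 q1 q2 : {poly F}) a :
  p1 != 0 -> p2 != 0 -> q1 != 0 -> q2 != 0 -> mup a q1 = mup a q2 ->
  p1 * q2 = p2 * q1 -> mup a p1 = mup a p2.
Proof.
move=> p10 p20 q10 q20 eq_q /(congr1 (mup a)).
by rewrite !mupM// eq_q => /addIn.
Qed.

Lemma mup_mul_comp (F : fieldType) (p r q : {poly F}) a :
  p != 0 -> r != 0 -> (1 < size q)%N ->
  mup a (p * (r \Po q)) = (mup a p + mup q.[a] r * mup a (q - q.[a]%:P))%N.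
Proof. by move=> p0 r0 q1; rewrite mupM ?comp_poly_eq0// mup_comp. Qed.

Lemma eq_mup_mul_comp (F : fieldType) (p1 p2 r1 r2 q : {poly F}) a :
  p1 != 0 -> p2 != 0 -> r1 != 0 -> r2 != 0 -> (1 < size q)%N ->
  mup a p1 = mup a p2 -> mup q.[a] r1 = mup q.[a] r2 ->
  mup a (p1 * (r1 \Po q)) = mup a (p2 * (r2 \Po q)).
Proof.
by move=> p10 p20 r10 r20 q1 eq_p eq_r; rewrite !mup_mul_comp// eq_p eq_r.
Qed.

(** Cross multiplication eliminates the shared factor [z], later [glue_cst x], without dividing by
    it, so [z] may be 0. *)
Lemma horner_cross_mul (F : fieldType) (p1 p2 i1 i2 c1 c2 q : {poly F}) (x d z : F) :
  d != 0 -> p1.[x] * d = i1.[x] * c1.[q.[x]] * z ->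
  p2.[x] * d = i2.[x] * c2.[q.[x]] * z ->
  (p1 * (i2 * (c2 \Po q))).[x] = (p2 * (i1 * (c1 \Po q))).[x].
Proof.
move=> d0 E1 E2; rewrite !hornerM !horner_comp; apply: (mulIf d0).
by rewrite mulrAC E1 [RHS]mulrAC E2; ring.
Qed.

Section IsolatedPoly.
Variables (R : realType) (B C : finType) (N : B -> C -> bool).

Lemma isolated_poly_neq0 : isolated_poly R N != 0.
Proof. by apply/prodf_neq0 => j _; rewrite polyXsubC_eq0. Qed.

Lemma mup_isolated_poly a : mup a (isolated_poly R N) =
  (\sum_(j < #|C|) ((col_deg N (enum_val j) != 0)%N%:R == a))%N.
Proof.
rewrite /isolated_poly mup_prod => [|j]; last by rewrite polyXsubC_eq0.
by apply: eq_bigr => j _; rewrite (@mup_XsubCX _ 1); case: eqP.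
Qed.

Lemma mup_isolated_poly_off a : a != 0 -> a != 1 ->
  mup a (isolated_poly R N) = 0%N.
Proof.
move=> a0 a1; rewrite mup_isolated_poly big1// => j _; case: (col_deg _ _ == _).
  by rewrite eq_sym (negbTE a0).
by rewrite eq_sym (negbTE a1).
Qed.

(** Each vertex of [C] contributes one factor, with root 0 or 1; hence either multiplicity
    determines the other. *)
Lemma mup_isolated_poly01 :
  (mup 0 (isolated_poly R N) + mup 1 (isolated_poly R N))%N = #|C|.
Proof.
rewrite !mup_isolated_poly -big_split /=.
transitivity (\sum_(j < #|C|) 1)%N; last by rewrite sum1_card card_ord.
apply: eq_bigr => j _; case: (col_deg _ _ == _) => /=.
  by rewrite eqxx eq_sym oner_eq0.
by rewrite eqxx oner_eq0.
Qed.

End IsolatedPoly.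

Lemma size_glue_quad (R : realType) (W B : finType) (s : pred W) h k :
  (0 < b_deg B s h k)%N -> (1 < size (glue_quad R B s h k))%N.
Proof.
rewrite /glue_quad; move: (b_deg _ _ _ _) => m m0; rewrite ltnNge.
apply/negP => /size1_polyC; set q := _ * _ => qE.
(* The value at 1 is 0, while at 3 it is [2 * (2 * m - h)], positive since [h <= 1 <= m]. *)
have : q.[1] = q.[3] by rewrite qE !hornerC.
rewrite /q !hornerE subrr mul0r => /esym/eqP; apply/negP.
rewrite mulf_neq0//; first by apply: lt0r_neq0; lra.
have m1 : 1 <= m%:R :> R by rewrite ler1n.
have h1 : h%:R <= 1 :> R by case: (h).
by apply: lt0r_neq0; lra.
Qed.

(** Cross-multiplying the two instances of [char_poly_glue] leaves only the Laplacian polynomials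
    and the products [K1], [K2], whose multiplicities agree by assumption. *)
Lemma cospectral_glue_mup (R : realType) (W B C V1 V2 : finType)
    (a : rel W) (s : pred W) h k
    (G1 : sgraph V1) (G2 : sgraph V2) (e1 : W + B + C -> V1) (e2 : W + B + C -> V2)
    (N1 N2 : B -> C -> bool) :
  bijective e1 -> bijective e2 ->
  (forall x y, G1 (e1 x) (e1 y) = glue a s h N1 x y) ->
  (forall x y, G2 (e2 x) (e2 y) = glue a s h N2 x y) ->
  (forall b, \sum_c N1 b c = k)%N -> (forall b, \sum_c N2 b c = k)%N ->
  (0 < b_deg B s h k)%N ->
  (forall x, mup x (char_poly (gram R N1)) = mup x (char_poly (gram R N2))) ->
  (forall x, mup x (isolated_poly R N1) = mup x (isolated_poly R N2)) ->
  cospectral R G1 G2.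
Proof.
move=> be1 be2 Ge1 Ge2 Nk1 Nk2 m0 eq_chi eq_iso x.
set q := glue_quad R B s h k; have q1 : (1 < size q)%N by apply: size_glue_quad.
have d0 (y : R) : y != 1 -> ((b_deg B s h k)%:R * (y - 1)) ^+ #|B| != 0.
  by move=> y1; rewrite expf_neq0 ?mulf_neq0 ?subr_eq0 ?pnatr_eq0 -?lt0n.
set K1 := isolated_poly R N1 * (char_poly (gram R N1) \Po q).
set K2 := isolated_poly R N2 * (char_poly (gram R N2) \Po q).
have chi0 n (A : 'M[R]_n) : char_poly A \Po q != 0.
  by rewrite comp_poly_eq0 ?char_poly_neq0.
have K1_neq0 : K1 != 0 by rewrite mulf_neq0 ?isolated_poly_neq0.
have K2_neq0 : K2 != 0 by rewrite mulf_neq0 ?isolated_poly_neq0.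
have eqK : mup x K1 = mup x K2.
  exact: (eq_mup_mul_comp (isolated_poly_neq0 R N1) (isolated_poly_neq0 R N2)
    (char_poly_neq0 _) (char_poly_neq0 _) q1 (eq_iso x) (eq_chi _)).
apply: (mup_cross_mul (char_poly_neq0 _) (char_poly_neq0 _) K1_neq0 K2_neq0 eqK).
apply: (eq_poly_off01 (chi0 _ (gram R N1)) (chi0 _ (gram R N2))) => y y0 y1 c1 c2.
rewrite horner_comp in c1; rewrite horner_comp in c2.
exact: (horner_cross_mul (d0 y y1) (char_poly_glue be1 Ge1 Nk1 m0 y0 y1 c1)
                            (char_poly_glue be2 Ge2 Nk2 m0 y0 y1 c2)).
Qed.

(* A bipartite graph is the case [W = void] of [glue]. *)
Definition bip_embed (B C : finType) (x : void + B + C) : B + C :=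
  match x with
  | inl (inl w) => match w with end
  | inl (inr b) => inl b
  | inr c => inr c
  end.

Lemma bip_embed_bij (B C : finType) : bijective (@bip_embed B C).
Proof.
exists (fun x => match x with inl b => inl (inr b) | inr c => inr c end).
  by case=> [[[]|]|].
by case.
Qed.

(** * Recovering the isolated vertices and the Gram spectrum from a bipartite spectrum *)

Section BipartiteCharPoly.
Variables (R : realType) (B C : finType) (k : nat).
Hypothesis k_gt0 : (0 < k)%N.

Let no_rel : rel void := fun _ _ => false.
Let no_pred : pred void := fun _ => false.
Let q := glue_quad R B no_pred false k.

Let b_degE : b_deg B no_pred false k = k.
Proof. by rewrite /b_deg big1 ?mul0n//; case. Qed.

Let q1 : (1 < size q)%N.
Proof. by apply: size_glue_quad; rewrite b_degE. Qed.

Let qE a : q.[a] = k%:R * (a - 1) ^+ 2.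
Proof. by rewrite /q /glue_quad b_degE !hornerE /=; ring. Qed.

Lemma char_poly_bipartite (P : sgraph (B + C)%type) (N : B -> C -> bool) :
  (forall x y, P (bip_embed x) (bip_embed y) = glue no_rel no_pred false N x y) ->
  (forall b, \sum_c N b c = k)%N ->
  char_poly (normalized_laplacian R P) * (k%:R *: ('X - 1%:P)) ^+ #|B| =
  isolated_poly R N * (char_poly (gram R N) \Po q).
Proof.
move=> PN Nk.
have c0 : char_poly (gram R N) \Po q != 0 by rewrite comp_poly_eq0 ?char_poly_neq0.
apply: (eq_poly_off01 c0 c0) => x x0 x1; rewrite (horner_comp _ q) => c _.
have m0 : (0 < b_deg B no_pred false k)%N by rewrite b_degE.
have E := char_poly_glue (bip_embed_bij B C) PN Nk m0 x0 x1 c.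
have dE : ((k%:R *: ('X - 1%:P)) ^+ #|B| : {poly R}).[x] =
    ((b_deg B no_pred false k)%:R * (x - 1)) ^+ #|B| by rewrite b_degE !hornerE.
rewrite hornerM dE {}E [RHS]hornerM horner_comp -[RHS]mulr1; congr (_ * _).
(* With [W] empty and [h] false, [glue_cst] is the determinant of an identity matrix. *)
rewrite /glue_cst -[RHS](det1 R (#|{:void}| + #|B|)); congr determinant.
have noW : 'I_#|{:void}| -> False by move=> i; case: (enum_val i).
apply/matrixP => i j.
case: (split_ordP i) => i' ->; first by case: (noW i').
case: (split_ordP j) => j' ->; first by case: (noW j').
by rewrite block_mxEdr !mul0r scale0r addr0 !mxE eq_shift.
Qed.

(** The spectrum gives, at each [a], the sum of [iso N a] and a positive multiple of [chi N q.[a]].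
    The two terms are separated in turn: [chi] at positive values, [iso] at 0, [iso] at 1, then
    [chi] at 0. *)
Lemma cospectral_bipartite_mup (P1 P2 : sgraph (B + C)%type) (N1 N2 : B -> C -> bool) :
  (forall x y, P1 (bip_embed x) (bip_embed y) = glue no_rel no_pred false N1 x y) ->
  (forall x y, P2 (bip_embed x) (bip_embed y) = glue no_rel no_pred false N2 x y) ->
  (forall b, \sum_c N1 b c = k)%N -> (forall b, \sum_c N2 b c = k)%N ->
  cospectral R P1 P2 ->
  (forall x, mup x (isolated_poly R N1) = mup x (isolated_poly R N2)) /\
  (forall x, mup x (char_poly (gram R N1)) = mup x (char_poly (gram R N2))).
Proof.
move=> PN1 PN2 Nk1 Nk2 P12.
have k0 : k%:R != 0 :> R by rewrite pnatr_eq0 -lt0n.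
have kR : 0 < k%:R :> R by rewrite ltr0n.
pose iso (N : B -> C -> bool) a := mup a (isolated_poly R N).
have iso_off N (a : R) : a != 0 -> a != 1 -> iso N a = 0%N.
  exact: mup_isolated_poly_off.
have iso01 N : (iso N 0%R + iso N 1%R)%N = #|C| by apply: mup_isolated_poly01.
pose chi (N : B -> C -> bool) b := mup b (char_poly (gram R N)).
pose d a := mup a (q - q.[a]%:P).
have chi_lt0 N (b : R) : b < 0 -> chi N b = 0%N.
  by move=> b0; apply/mupNroot/char_poly_gram_lt0.
have d_gt0 a : (0 < d a)%N by apply: mup_sub_horner_gt0.
have kX : k%:R *: ('X - 1%:P) != 0 :> {poly R}.
  by rewrite scaler_eq0 negb_or k0 polyXsubC_eq0.
have eqPN (P : sgraph (B + C)%type) (N : B -> C -> bool) (a : R) :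
    (forall x y, P (bip_embed x) (bip_embed y) = glue no_rel no_pred false N x y) ->
    (forall b, \sum_c N b c = k)%N ->
    (mup a (char_poly (normalized_laplacian R P)) +
     mup a ((k%:R *: ('X - 1%:P)) ^+ #|B|) = iso N a + chi N q.[a] * d a)%N.
  move=> PN Nk; rewrite -(mupM _ (char_poly_neq0 _) (expf_neq0 _ kX)).
  rewrite (char_poly_bipartite PN Nk).
  exact: (mup_mul_comp _ (isolated_poly_neq0 R N) (char_poly_neq0 _) q1).
have eq12 a : (iso N1 a + chi N1 q.[a] * d a = iso N2 a + chi N2 q.[a] * d a)%N.
  apply: etrans (eqPN _ _ a PN2 Nk2); rewrite -(P12 a).
  exact: esym (eqPN _ _ a PN1 Nk1).
suff : (forall x, iso N1 x = iso N2 x) /\ (forall x, chi N1 x = chi N2 x) by [].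
clearbody iso chi d.
have chi_gt0 (b : R) : 0 < b -> chi N1 b = chi N2 b.
  (* The point [1 + r] solves [q.[a] = b] and differs from 0 and 1, so the [iso] terms vanish
     there. *)
  move=> b0; pose r : R := Num.sqrt (b / k%:R).
  have r_gt0 : 0 < r by rewrite sqrtr_gt0 divr_gt0.
  have /eqP := eq12 (1 + r).
  have r0 : 1 + r != 0 by apply: lt0r_neq0; lra.
  have r1 : 1 + r != 1 by rewrite -subr_eq0; apply: lt0r_neq0; lra.
  rewrite !iso_off//.
  rewrite !add0n eqn_pmul2r// qE (_ : _ * _ = b) => [/eqP//|].
  by rewrite addrAC subrr add0r sqr_sqrtr ?divr_ge0 ?ltW// mulrCA divff ?mulr1.
(* Since [q.[0] = k] is positive, the [chi] terms at 0 are already known to agree. *)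
have iso0 : iso N1 0 = iso N2 0.
  by have := eq12 0; rewrite qE sub0r sqrrN expr1n mulr1 chi_gt0// => /addIn.
have iso1 : iso N1 1 = iso N2 1.
  by apply: (@addnI (iso N1 0)); rewrite iso01 iso0 iso01.
split=> x.
  have [->//|x0] := eqVneq x 0; have [->//|x1] := eqVneq x 1.
  by rewrite !iso_off.
have [x0|/chi_gt0//|->] := ltrgtP x 0; first by rewrite !chi_lt0.
(* As [q.[1] = 0], the equation at 1 settles the multiplicity of 0 in the Gram spectrum. *)
have := eq12 1; rewrite iso1 => /addnI/eqP; rewrite eqn_pmul2r//.
by rewrite qE subrr expr0n mulr0 => /eqP.
Qed.

End BipartiteCharPoly.

(** * From cospectral bipartite graphs to the graphs of the theorem *)

Lemma cospectral_glue (R : realType) (W B C V : finType)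
    (a : rel W) (s : pred W) h k
    (G1 G2 : sgraph V) (e : W + B + C -> V) (P1 P2 : sgraph (B + C)%type)
    (N1 N2 : B -> C -> bool) :
  bijective e ->
  (forall x y, G1 (e x) (e y) = glue a s h N1 x y) ->
  (forall x y, G2 (e x) (e y) = glue a s h N2 x y) ->
  (forall x y, P1 (bip_embed x) (bip_embed y) =
     glue (fun _ _ => false) (fun _ => false) false N1 x y) ->
  (forall x y, P2 (bip_embed x) (bip_embed y) =
     glue (fun _ _ => false) (fun _ => false) false N2 x y) ->
  (forall b, \sum_c N1 b c = k)%N -> (forall b, \sum_c N2 b c = k)%N ->
  cospectral R P1 P2 -> cospectral R G1 G2.
Proof.
move=> be Ge1 Ge2 PN1 PN2 Nk1 Nk2 P12; have [k0|k_gt0] := posnP k; last first.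
  have [eq_iso eq_chi] := cospectral_bipartite_mup k_gt0 PN1 PN2 Nk1 Nk2 P12.
  apply: (cospectral_glue_mup be be Ge1 Ge2 Nk1 Nk2) => //.
  by rewrite /b_deg addn_gt0 k_gt0 orbT.
(* For [k = 0] both biadjacency relations are empty, so [G1] and [G2] have the same edges. *)
have N0 (N : B -> C -> bool) : (forall b, \sum_c N b c = k)%N ->
    forall b c, N b c = false.
  rewrite k0 => Nk b c; have /eqP := Nk b; rewrite sum_nat_eq0.
  by move=> /forallP/(_ c); case: (N b c).
case: be => e' eK Ke; apply: eq_adj_cospectral => x y; rewrite -(Ke x) -(Ke y) Ge1 Ge2.
by case: (e' x) (e' y) => [[?|?]|?] [[?|?]|?] //=; rewrite (N0 _ Nk1) (N0 _ Nk2).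
Qed.

Definition graph_embed (W B C : finType) (x : W + B + C) : W + (B + C) :=
  match x with
  | inl (inl w) => inl w
  | inl (inr b) => inr (inl b)
  | inr c => inr (inr c)
  end.

Lemma graph_embed_bij (W B C : finType) : bijective (@graph_embed W B C).
Proof.
exists (fun x => match x with
  | inl w => inl (inl w) | inr (inl b) => inl (inr b) | inr (inr c) => inr c end).
  by case=> [[]|].
by case=> [|[]].
Qed.

Lemma no_edges_imset (V S T : finType) (G : sgraph V) (f : S -> V) (g : T -> V) :
  no_edges_between G [set f x | x : S] [set g y | y : T] ->
  forall x y, G (f x) (g y) = false.
Proof. by move=> noG x y; apply/negbTE/noG; apply: imset_f. Qed.

Lemma glue_bipartite (B C : finType) (P : sgraph (B + C)%type) :
  no_edges_between P [set inl b | b : B] [set inl b | b : B] ->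
  no_edges_between P [set inr c | c : C] [set inr c | c : C] ->
  forall x y, P (bip_embed x) (bip_embed y) =
    glue (fun _ _ => false) (fun _ => false) false (fun b c => P (inl b) (inr c)) x y.
Proof.
move=> PB PC [[[]|b]|c] [[[]|b']|c'] //=; last 2 first.
- by rewrite adj_sym.
- exact: no_edges_imset PC _ _.
exact: no_edges_imset PB _ _.
Qed.

Lemma row_sum_bipartite (B C : finType) (P : sgraph (B + C)%type) k :
  no_edges_between P [set inl b | b : B] [set inl b | b : B] ->
  (forall b : B, degree P (inl b) = k) ->
  forall b, (\sum_c P (inl b) (inr c))%N = k.
Proof.
move=> PB Pk b; rewrite -(Pk b) degreeE big_sumType /= [X in (X + _)%N]big1// => b' _.
by rewrite (no_edges_imset PB).
Qed.

Theorem theorem1 (R : realType) (A A' B C : finType) (k : nat)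
    (P1 P2 : sgraph (B + C)%type)
    (G1 G2 : sgraph ((A + A') + (B + C))%type)
    (P1_B : no_edges_between P1 [set inl b | b : B] [set inl b | b : B])
    (P1_C : no_edges_between P1 [set inr c | c : C] [set inr c | c : C])
    (P2_B : no_edges_between P2 [set inl b | b : B] [set inl b | b : B])
    (P2_C : no_edges_between P2 [set inr c | c : C] [set inr c | c : C])
    (P1_deg : forall b : B, degree P1 (inl b) = k)
    (P2_deg : forall b : B, degree P2 (inl b) = k)
    (P1_P2 : cospectral R P1 P2)
    (G1_B : no_edges_between G1
              [set inr (inl b) | b : B] [set inr (inl b) | b : B])
    (G1_C : no_edges_between G1
              [set inr (inr c) | c : C] [set inr (inr c) | c : C])
    (G1_AB : no_edges_between G1
               [set inl (inl a) | a : A] [set inr (inl b) | b : B])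
    (G1_AC : no_edges_between G1
               [set inl (inl a) | a : A] [set inr (inr c) | c : C])
    (G1_A'C : no_edges_between G1
                [set inl (inr a') | a' : A'] [set inr (inr c) | c : C])
    (G1_A'B : forall (a' : A') (b : B), G1 (inl (inr a')) (inr (inl b)))
    (G1_BC : forall x y : B + C, G1 (inr x) (inr y) = P1 x y)
    (G2_G1 : same_except_inside [set inr x | x : B + C] G1 G2)
    (G2_BC : forall x y : B + C, G2 (inr x) (inr y) = P2 x y) :
  cospectral R G1 G2 /\
  (dim_eigenspace_on [set inl b | b : B] (1 : R) P1 =
     dim_eigenspace_on [set inl b | b : B] (1 : R) P2 ->
   forall H1 H2 : sgraph ((A + A') + (B + C))%type,
     same_except_inside [set inr (inl b) | b : B] G1 H1 ->
     complete_on [set inr (inl b) | b : B] H1 ->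
     same_except_inside [set inr (inl b) | b : B] G2 H2 ->
     complete_on [set inr (inl b) | b : B] H2 ->
     cospectral R H1 H2).
Proof.
(* The set [W] of the glued graphs is [A + A'], and the vertices joined to [B] are those of [A']. *)
pose a (w w' : A + A') := G1 (inl w) (inl w').
pose s (w : A + A') := if w is inr _ then true else false.
pose N (P : sgraph (B + C)%type) b c := P (inl b) (inr c).
have PN1 := glue_bipartite P1_B P1_C.
have PN2 := glue_bipartite P2_B P2_C.
have Nk1 := row_sum_bipartite P1_B P1_deg.
have Nk2 := row_sum_bipartite P2_B P2_deg.
have bij := graph_embed_bij (A + A')%type B C.
have inlN w : (inl w : A + A' + (B + C)) \notin [set inr x | x : B + C].
  by apply/imsetP => -[].
have G2l w x : G2 (inl w) x = G1 (inl w) x by apply: G2_G1; rewrite (negbTE (inlN w)).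
have GsB w b : G1 (inl w) (inr (inl b)) = s w.
  by case: w => [w|w] /=; [apply: no_edges_imset G1_AB _ _ | apply: G1_A'B].
have GsC w c : G1 (inl w) (inr (inr c)) = false.
  by case: w => w; [apply: no_edges_imset G1_AC _ _ | apply: no_edges_imset G1_A'C _ _].
have glueG (G : sgraph ((A + A') + (B + C))%type) (P : sgraph (B + C)%type) :
    (forall w x, G (inl w) x = G1 (inl w) x) ->
    (forall x y, G (inr x) (inr y) = P x y) ->
    no_edges_between P [set inl b | b : B] [set inl b | b : B] ->
    no_edges_between P [set inr c | c : C] [set inr c | c : C] ->
    forall x y, G (graph_embed x) (graph_embed y) = glue a s false (N P) x y.
  move=> Gl Gr PB PC [[w|b]|c] [[w'|b']|c'] /=;
    rewrite ?Gl ?[G (inr _) (inl _)]adj_sym ?Gl ?Gr ?GsB ?GsC//.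
  - exact: no_edges_imset PB _ _.
  - by rewrite adj_sym.
  - exact: no_edges_imset PC _ _.
have gl1 := glueG G1 P1 (fun _ _ => erefl) G1_BC P1_B P1_C.
have gl2 := glueG G2 P2 G2l G2_BC P2_B P2_C.
split=> [|_ H1 H2 HG1 HB1 HG2 HB2].
  exact: (cospectral_glue bij gl1 gl2 PN1 PN2 Nk1 Nk2 P1_P2).
(* Completing [B] only switches [h] to true: the eight other blocks have an endpoint outside [B],
   where [H] agrees with [G]. *)
have glueH (G H : sgraph ((A + A') + (B + C))%type) (P : sgraph (B + C)%type) :
    (forall x y, G (graph_embed x) (graph_embed y) = glue a s false (N P) x y) ->
    same_except_inside [set inr (inl b) | b : B] G H ->
    complete_on [set inr (inl b) | b : B] H ->
    forall x y, H (graph_embed x) (graph_embed y) = glue a s true (N P) x y.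
  move=> gl HG HB [[w|b]|c] [[w'|b']|c'];
    try by rewrite HG ?gl//; apply/nandP;
      by [left; apply/imsetP => -[] | right; apply/imsetP => -[]].
  by rewrite HB //; apply/imsetP; eexists.
exact: (cospectral_glue bij (glueH _ _ _ gl1 HG1 HB1) (glueH _ _ _ gl2 HG2 HB2)
  PN1 PN2 Nk1 Nk2 P1_P2).
Qed.
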